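(* Every quasi-monotonic function $f:[n]\to[m]$ in $\mathbf{Fin}$ has a unique factorization of the form $f=d_\alpha u_\beta$, where $\alpha$ and $\beta$ are multi-indices (with $\alpha$ of dimension $\le m$, $\beta$ of dimension $\le n$, and $n-|\beta|=m-|\alpha|$).
   Context: For $n\ge0$, $[n]=\{0,1,\dots,n\}$; $\mathbf{Fin}$ is the category with objects $[n]$ and morphisms all functions between them. Products denote ordinary composition of functions (the rightmost factor is applied first). A function $f:[n]\to[m]$ is quasi-monotonic if (QM1) $f(0)=0$, and (QM2) whenever $f(p)\ne0\ne f(q)$ and $p<q$, then $f(p)<f(q)$. $d_i:[n-1]\to[n]$ ($n\ge1$, $0\le i\le n$) is $k\mapsto k$ for $k<i$, $k\mapsto k+1$ for $k\ge i$. $u_i:[n+1]\to[n]$ ($n\ge0$, $1\le i\le n+1$) is $0\mapsto0$, $i\mapsto0$, $k\mapsto k$ for $1\le k\le i-1$, $k\mapsto k-1$ for $k>i$. A multi-index $\alpha$ of length $k\ge0$ and dimension $\le n$ is a strictly increasing sequence $i_1<\dots<i_k$ with $1\le i_p\le n$; $|\alpha|=k$. Set $u_\alpha=u_{i_1}u_{i_2}\cdots u_{i_k}:[n]\to[n-|\alpha|]$ and $d_\alpha=d_{i_k}d_{i_{k-1}}\cdots d_{i_1}:[n-|\alpha|]\to[n]$ (both are the identity for empty $\alpha$). *)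

(* Defs.v *)
From mathcomp Require Import all_boot.

(* The object [n] = {0, ..., n} of Fin is the type 'I_n.+1. *)

Definition quasi_monotonic {n m : nat} (f : 'I_n.+1 -> 'I_m.+1) : Prop :=
  f ord0 = ord0 /\
  (forall p q : 'I_n.+1, f p != ord0 -> f q != ord0 -> p < q -> f p < f q).

(* d_i : [n-1] -> [n] and u_i : [n] -> [n-1].  Indices are plain naturals and
   n is arbitrary, so that both can be iterated along a list.  They have their
   intended meaning for 0 < n, with i <= n for d_i and 1 <= i <= n for u_i:
   then inord does not truncate (val_dface and val_ucollapse below).  The
   remaining values are junk; they are not used by umulti and dmulti below at a
   multi-index i_1 < ... < i_k <= n, since i_p <= n - (k - p). *)
Definition dface {n : nat} (i : nat) (k : 'I_n.-1.+1) : 'I_n.+1 :=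
  inord (if k < i then k : nat else k.+1).

Definition ucollapse {n : nat} (i : nat) (k : 'I_n.+1) : 'I_n.-1.+1 :=
  inord (if k == i :> nat then 0 else if k < i then k : nat else k.-1).

Lemma val_dface n i (k : 'I_n.-1.+1) : 0 < n ->
  dface i k = (if k < i then k : nat else k.+1) :> nat.
Proof.
case: n k => // n k _; rewrite /dface inordK //.
by case: ifP => _; [exact: ltnW (ltn_ord k) | exact: ltn_ord k].
Qed.

Lemma val_ucollapse n i (k : 'I_n.+1) : 0 < i <= n ->
  ucollapse i k =
    (if k == i :> nat then 0 else if k < i then k : nat else k.-1) :> nat.
Proof.
move=> /andP[i_gt0 le_in]; have n_gt0 := leq_trans i_gt0 le_in.
rewrite /ucollapse inordK // (prednK n_gt0).
case: eqP => // _; case: (ltnP k i) => [lt_ki | le_ik].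
  exact: leq_trans lt_ki le_in.
by rewrite (prednK (leq_trans i_gt0 le_ik)) -ltnS ltn_ord.
Qed.

(* alpha is a multi-index of dimension <= n; its length |alpha| is
   size alpha, which is at most n, so n - size alpha is not truncated *)
Definition multi_index n (alpha : seq nat) : bool :=
  sorted ltn alpha && all (fun i => 0 < i <= n) alpha.

(* u_(i_1 ... i_k) = u_(i_1) u_(i_2) ... u_(i_k) *)
Fixpoint umulti n (alpha : seq nat) : 'I_n.+1 -> 'I_(n - size alpha).+1 :=
  match alpha return 'I_n.+1 -> 'I_(n - size alpha).+1 with
  | [::] => cast_ord (congr1 succn (esym (subn0 n)))
  | i :: alpha' =>
      cast_ord (congr1 succn (esym (subnS n (size alpha'))))
        \o ucollapse i \o umulti n alpha'
  end.

(* d_(i_1 ... i_k) = d_(i_k) ... d_(i_2) d_(i_1) *)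
Fixpoint dmulti n (alpha : seq nat) : 'I_(n - size alpha).+1 -> 'I_n.+1 :=
  match alpha return 'I_(n - size alpha).+1 -> 'I_n.+1 with
  | [::] => cast_ord (congr1 succn (subn0 n))
  | i :: alpha' =>
      dmulti n alpha' \o dface i
        \o cast_ord (congr1 succn (subnS n (size alpha')))
  end.

(* f = d_alpha u_beta; the equation e makes the two maps composable *)
Definition factors_as {n m : nat} (f : 'I_n.+1 -> 'I_m.+1) (alpha beta : seq nat) :=
  exists e : n - size beta = m - size alpha,
    f =1 dmulti m alpha \o cast_ord (congr1 succn e) \o umulti n beta.

(* Main.v *)
Require Import Defs.
From mathcomp Require Import all_boot.

(** A multi-index [alpha] is the increasing enumeration of a subset of
    [{1, ..., n}].  The map [u_alpha] sends that subset to [0] and numbers the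
    remaining elements in increasing order (lemma [val_umulti]), so it is
    injective off [alpha]; and [d_alpha] is the section of [u_alpha] with image
    the complement of [alpha] ([umultiK], [dmulti_notin], [dmultiK]).

    Hence [f = d_alpha u_beta] leaves no choice: [beta] must be the set of
    nonzero points that [f] sends to [0], and [alpha] the set of points outside
    the image of [f].  Conversely, for these [alpha] and [beta], a
    quasi-monotonic [f] is an increasing bijection from the points off [beta]
    onto the points off [alpha] (zero aside), so it preserves the numbering of
    both ([rank_quasi_monotonic]).  This says that the intermediate objects
    agree and that [u_alpha f = u_beta], and applying [d_alpha] to the latter
    gives the factorization. *)

(** * Multi-indices as subsets *)

Lemma multi_index_cons {n i alpha} : multi_index n (i :: alpha) ->
  [/\ 0 < i <= n, all (ltn i) alpha & multi_index n alpha].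
Proof.
rewrite /multi_index /= (path_sortedE ltn_trans).
by case/andP=> /andP[-> ->] /andP[-> ->].
Qed.

Lemma multi_index_bounds {n alpha i} : multi_index n alpha -> i \in alpha ->
  0 < i <= n.
Proof. by case/andP=> _ /allP; apply. Qed.

Lemma multi_index_inj n alpha beta :
  multi_index n alpha -> multi_index n beta ->
  (forall i : 'I_n.+1, ((i : nat) \in alpha) = ((i : nat) \in beta)) -> alpha = beta.
Proof.
move=> mi_a mi_b eq_ab; have /andP[sa _] := mi_a; have /andP[sb _] := mi_b.
apply: (irr_sorted_eq ltn_trans ltnn sa sb) => i.
case: (ltnP i n.+1) => [lt_in | le_ni]; first exact: (eq_ab (Ordinal lt_in)).
by apply/idP/idP => [/(multi_index_bounds mi_a)|/(multi_index_bounds mi_b)];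
  rewrite (leqNgt i) le_ni andbF.
Qed.

(** On the range [1, ..., n] the ordinal [inord i] has value [i]. *)
Definition index_of {n} (P : pred 'I_n.+1) : seq nat :=
  [seq i <- iota 1 n | P (inord i)].

Lemma mem_index_of n (P : pred 'I_n.+1) (i : 'I_n.+1) :
  ((i : nat) \in index_of P) = (0 < i) && P i.
Proof. by rewrite mem_filter mem_iota add1n ltn_ord andbT inord_val andbC. Qed.

Lemma multi_index_of n (P : pred 'I_n.+1) : multi_index n (index_of P).
Proof.
apply/andP; split; first exact: sorted_filter ltn_trans _ _ (iota_ltn_sorted _ _).
by apply/allP => i; rewrite mem_filter mem_iota add1n ltnS => /andP[].
Qed.

(** * The numbering of the complement of a multi-index *)

Definition rank (alpha : seq nat) k := count (fun j => j \notin alpha) (iota 1 k).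

Lemma leq_rank alpha j k : j <= k -> rank alpha j <= rank alpha k.
Proof.
by move=> /subnKC <-; rewrite /rank iotaD count_cat leq_addr.
Qed.

Lemma ltn_rank alpha j k : j < k -> k \notin alpha -> rank alpha j < rank alpha k.
Proof.
case: k => // k; rewrite ltnS => le_jk k_notin.
rewrite [rank _ k.+1]/rank -[k.+1]addn1 iotaD count_cat /= add1n k_notin addn1 ltnS.
exact: leq_rank.
Qed.

Lemma rank_id alpha k : all (ltn k) alpha -> rank alpha k = k.
Proof.
move=> /allP gt_k; rewrite /rank -[RHS](size_iota 1 k); apply/eqP.
rewrite -all_count; apply/allP => j; rewrite mem_iota add1n ltnS => /andP[_ le_jk].
by apply: contraL le_jk => /gt_k; rewrite -ltnNge.
Qed.

Lemma rank_cons i alpha k : 0 < i -> i \notin alpha ->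
  rank alpha k = rank (i :: alpha) k + (i <= k).
Proof.
move=> i_gt0 i_notin; have <-: count_mem i (iota 1 k) = (i <= k).
  by rewrite count_uniq_mem ?iota_uniq // mem_iota i_gt0 add1n ltnS.
rewrite /rank -count_predUI [X in _ + X](eq_count (a2 := pred0)) => [|j] /=.
  rewrite count_pred0 addn0; apply: eq_count => j /=; rewrite inE negb_or.
  by case: (j =P i) => [->|]; rewrite ?orbT ?orbF.
by rewrite inE; case: (j == i); rewrite ?andbF.
Qed.

Lemma rank_dim {n alpha} : multi_index n alpha -> rank alpha n = n - size alpha.
Proof.
move=> mi_a; have /andP[sa _] := mi_a.
have <-: count (mem alpha) (iota 1 n) = size alpha.
  rewrite -size_filter; apply/perm_size/uniq_perm.
  - by rewrite filter_uniq ?iota_uniq.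
  - exact: sorted_uniq ltn_trans ltnn _ sa.
  move=> i; rewrite mem_filter mem_iota add1n ltnS.
  by apply: andb_idr => /(multi_index_bounds mi_a).
by rewrite -[X in X - _](size_iota 1 n) -(count_predC (mem alpha)) addKn.
Qed.

(** A cardinality can be transported along a bijection between finite types,
    as [rank_quasi_monotonic] does. *)
Lemma rank_card n alpha k : k <= n ->
  rank alpha k = #|[set i : 'I_n.+1 | (0 < i <= k) && ((i : nat) \notin alpha)]|.
Proof.
move=> le_kn.
rewrite cardsE cardE /enum_mem size_filter -enumT.
rewrite -(count_map val (fun i => (0 < i <= k) && (i \notin alpha))).
rewrite val_enum_ord /= add0n -(subnKC le_kn) iotaD count_cat.
rewrite [X in _ + X](eq_in_count (a2 := pred0)) => [|i] /=.
  rewrite count_pred0 addn0; apply: eq_in_count => i.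
  by rewrite mem_iota add1n ltnS => ->.
by rewrite mem_iota add1n => /andP[lt_ki _]; rewrite (leqNgt i) lt_ki andbF.
Qed.

(** * The maps given by a multi-index *)

(** The index [i] lies in the range where [u_i] and [d_i] have their intended
    meaning: the [i] elements [1, ..., i] are all outside [alpha]. *)
Lemma multi_index_head {n i alpha} : multi_index n (i :: alpha) ->
  0 < i <= n - size alpha.
Proof.
move=> /multi_index_cons[/andP[-> le_in] gt_i mi_a] /=.
by rewrite -(rank_dim mi_a) -{1}(rank_id _ _ gt_i) leq_rank.
Qed.

(** As [i] is smaller than every element of [alpha], the map [u_alpha] fixes
    [0, ..., i] and sends the later elements off [alpha] above [i]; so the last
    factor of [u_(i :: alpha)] collapses [i] itself and lowers just those later
    values by one. *)
Lemma val_umulti n alpha (k : 'I_n.+1) : multi_index n alpha ->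
  umulti n alpha k = (if (k : nat) \in alpha then 0 else rank alpha k) :> nat.
Proof.
elim: alpha => [|i alpha IH] mi_ia; first by rewrite /= rank_id.
have [/andP[i_gt0 _] gt_i mi_a] := multi_index_cons mi_ia.
have i_notin : i \notin alpha.
  by apply/negP => /(allP gt_i) /=; rewrite ltnn.
have rank_i : rank alpha i = i by apply: rank_id.
rewrite [LHS]/= val_ucollapse ?multi_index_head // IH // inE.
case: (boolP (nat_of_ord k \in alpha)) => [k_in | k_notin].
  by rewrite orbT eq_sym (gtn_eqF i_gt0) i_gt0.
rewrite orbF (rank_cons _ _ k i_gt0 i_notin).
case: (ltngtP (nat_of_ord k) i) => [lt_ki | lt_ik | ->].
- have := ltn_rank _ _ _ lt_ki i_notin.
  rewrite (rank_cons _ _ k i_gt0 i_notin) (leqNgt i) lt_ki addn0 rank_i => lt_ri.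
  by rewrite (ltn_eqF lt_ri) lt_ri.
- have := ltn_rank _ _ _ lt_ik k_notin.
  rewrite (rank_cons _ _ k i_gt0 i_notin) (ltnW lt_ik) addn1 rank_i => lt_ir.
  by rewrite (gtn_eqF lt_ir) ltnNge (ltnW lt_ir).
- by have := rank_cons _ _ i i_gt0 i_notin; rewrite leqnn => <-; rewrite rank_i eqxx.
Qed.

Lemma umulti_eq0 n alpha (k : 'I_n.+1) : multi_index n alpha ->
  (umulti n alpha k == ord0) = (k == ord0) || ((k : nat) \in alpha).
Proof.
move=> mi_a; rewrite -val_eqE /= val_umulti //.
case: ifPn => [_ | k_notin]; first by rewrite orbT.
rewrite orbF -val_eqE /=; case: (posnP k) => [-> // | k_gt0].
by rewrite (gtn_eqF (leq_ltn_trans _ (ltn_rank _ _ _ k_gt0 k_notin))).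
Qed.

Lemma umulti_inj n alpha : multi_index n alpha ->
  {in [pred k : 'I_n.+1 | (k : nat) \notin alpha] &, injective (umulti n alpha)}.
Proof.
move=> mi_a j k; rewrite !inE => j_notin k_notin /(congr1 val) /=.
rewrite !val_umulti // (negPf j_notin) (negPf k_notin) => eq_rank.
apply: val_inj; case: (ltngtP (nat_of_ord j) (nat_of_ord k)) => // [lt_jk | lt_kj].
  by have := ltn_rank _ _ _ lt_jk k_notin; rewrite eq_rank ltnn.
by have := ltn_rank _ _ _ lt_kj j_notin; rewrite eq_rank ltnn.
Qed.

Lemma dfaceK n i : 0 < i <= n -> cancel (@dface n i) (@ucollapse n i).
Proof.
move=> i_bounds k; have /andP[i_gt0 le_in] := i_bounds.
apply: val_inj; rewrite /= val_ucollapse // val_dface ?(leq_trans i_gt0) //.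
case: (ltnP k i) => [lt_ki | le_ik]; first by rewrite (ltn_eqF lt_ki) lt_ki.
by rewrite (gtn_eqF (le_ik : i < k.+1)) ltnNge (leqW le_ik).
Qed.

Lemma umultiK n alpha : multi_index n alpha ->
  cancel (dmulti n alpha) (umulti n alpha).
Proof.
elim: alpha => [|i alpha IH] mi_ia x; first exact: val_inj.
have [_ _ mi_a] := multi_index_cons mi_ia.
by rewrite /= IH // dfaceK ?multi_index_head //; apply: val_inj.
Qed.

Lemma dmulti0 n alpha : multi_index n alpha -> dmulti n alpha ord0 = ord0.
Proof.
elim: alpha => [|i alpha IH] mi_ia; first exact: val_inj.
have [_ _ mi_a] := multi_index_cons mi_ia.
have /andP[i_gt0 le_i] := multi_index_head mi_ia.
rewrite /= -[RHS](IH mi_a); congr (dmulti n alpha _); apply: val_inj.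
by rewrite /= val_dface ?(leq_trans i_gt0) //= i_gt0.
Qed.

(** If [d_alpha x] lay in [alpha], then [x = u_alpha (d_alpha x)] would be [0];
    but [d_alpha] fixes [0], which is not in [alpha]. *)
Lemma dmulti_notin n alpha x : multi_index n alpha ->
  (dmulti n alpha x : nat) \notin alpha.
Proof.
move=> mi_a; apply/negP => d_in.
have := umulti_eq0 _ _ (dmulti n alpha x) mi_a.
rewrite umultiK // d_in orbT => /eqP x0.
by have := multi_index_bounds mi_a d_in; rewrite x0 dmulti0.
Qed.

Lemma dmultiK n alpha (k : 'I_n.+1) : multi_index n alpha -> (k : nat) \notin alpha ->
  dmulti n alpha (umulti n alpha k) = k.
Proof.
move=> mi_a k_notin; apply: (umulti_inj _ _ mi_a); rewrite ?inE ?dmulti_notin //.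
by rewrite umultiK.
Qed.

(** * The multi-indices of a map *)

Definition zeros {n m} (f : 'I_n.+1 -> 'I_m.+1) : seq nat :=
  index_of (fun p => f p == ord0).

Definition omitted {n m} (f : 'I_n.+1 -> 'I_m.+1) : seq nat :=
  index_of (fun q => q \notin codom f).

(** [f] restricts to a bijection from the points up to [p] off [zeros f] onto
    the points up to [y] off [omitted f].  The hypothesis holds for [y = f p]
    when [f p] is nonzero, and for [p = n] and [y = m]. *)
Lemma rank_quasi_monotonic n m (f : 'I_n.+1 -> 'I_m.+1) p y :
  quasi_monotonic f -> p <= n -> y <= m ->
  (forall b, f b != ord0 -> (b <= p) = (f b <= y)) ->
  rank (zeros f) p = rank (omitted f) y.
Proof.
move=> [f0 f_mono] le_pn le_ym eq_le; rewrite (rank_card n) // (rank_card m) //.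
have f_inj : {in [pred b | f b != ord0] &, injective f}.
  move=> a b; rewrite !inE => fa fb eq_f; apply: val_inj.
  case: (ltngtP (nat_of_ord a) (nat_of_ord b)) => // [lt_ab | lt_ba].
    by have := f_mono _ _ fa fb lt_ab; rewrite eq_f ltnn.
  by have := f_mono _ _ fb fa lt_ba; rewrite eq_f ltnn.
rewrite -(card_in_imset (f := f)); last first.
  move=> a b; rewrite !inE !mem_index_of.
  move=> /andP[/andP[a0 _]]; rewrite a0 => fa /andP[/andP[b0 _]]; rewrite b0 => fb.
  exact: f_inj.
apply: eq_card => q; rewrite inE mem_index_of; apply/imsetP/idP.
  case=> b; rewrite inE mem_index_of => /andP[/andP[b0 le_bp]].
  rewrite b0 /= => fb ->; rewrite codom_f /= andbF andbT -eq_le // le_bp andbT.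
  by rewrite lt0n.
case/andP=> /andP[q0 le_qy]; rewrite q0 /= negbK => /codomP[b def_q].
have fb : f b != ord0 by rewrite -def_q -val_eqE /= -lt0n.
have b0 : 0 < b.
  rewrite lt0n; apply: contraNneq fb => b0.
  by rewrite (_ : b = ord0) ?f0 //; apply: val_inj.
by exists b; rewrite // inE mem_index_of b0 (negPf fb) eq_le // -def_q le_qy.
Qed.

Lemma factors_quasi_monotonic n m (f : 'I_n.+1 -> 'I_m.+1) :
  quasi_monotonic f -> factors_as f (omitted f) (zeros f).
Proof.
move=> f_qm; have [f0 f_mono] := f_qm.
have mi_a : multi_index m (omitted f) by apply: multi_index_of.
have mi_b : multi_index n (zeros f) by apply: multi_index_of.
have e : n - size (zeros f) = m - size (omitted f).
  rewrite -(rank_dim mi_a) -(rank_dim mi_b); apply: rank_quasi_monotonic => // b _.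
  by rewrite !leq_ord.
exists e => p /=.
have fp_notin : (f p : nat) \notin omitted f by rewrite mem_index_of codom_f andbF.
rewrite -[LHS](dmultiK _ _ _ mi_a fp_notin); congr (dmulti m _ _).
apply: val_inj; rewrite /= !val_umulti // (negPf fp_notin) mem_index_of.
case: (eqVneq (f p) ord0) => [fp0 | fp]; rewrite ?andbT ?andbF.
  by rewrite fp0; case: (posnP (nat_of_ord p)) => [-> |].
apply/esym/rank_quasi_monotonic; rewrite ?leq_ord // => b fb.
apply/idP/idP; last by apply: contraLR; rewrite -!ltnNge; apply: f_mono.
rewrite leq_eqVlt => /predU1P[/val_inj -> // | lt_bp].
exact/ltnW/f_mono.
Qed.

(** Since [d_alpha] is injective and fixes [0], the zeros of [f] are those of
    [u_beta]; since [u_beta] is surjective, [f] has the image of [d_alpha]. *)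
Lemma factors_as_unique n m (f : 'I_n.+1 -> 'I_m.+1) alpha beta :
  multi_index m alpha -> multi_index n beta -> factors_as f alpha beta ->
  alpha = omitted f /\ beta = zeros f.
Proof.
move=> mi_a mi_b [e def_f].
split.
  apply: (multi_index_inj _ _ _ mi_a (multi_index_of _ _)) => q.
  rewrite mem_index_of; apply/idP/andP.
    move=> q_in; split; first by case/andP: (multi_index_bounds mi_a q_in).
    by apply: contraL q_in => /codomP[p ->]; rewrite def_f dmulti_notin.
  case=> _; apply: contraR => q_notin; apply/codomP.
  exists (dmulti n beta (cast_ord (congr1 succn (esym e)) (umulti m alpha q))).
  by rewrite def_f /= umultiK // cast_ord_comp cast_ord_id dmultiK.
apply: (multi_index_inj _ _ _ mi_b (multi_index_of _ _)) => p.
rewrite mem_index_of def_f /= -[in RHS](dmulti0 _ _ mi_a).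
rewrite (can_eq (umultiK _ _ mi_a)) -[_ == ord0]/(umulti n beta p == ord0).
rewrite umulti_eq0 // -val_eqE lt0n /=; case: (posnP (nat_of_ord p)) => [-> | _] /=.
  by apply/negP => /(multi_index_bounds mi_b).
by [].
Qed.

Theorem mainTheorem2 (n m : nat) (f : 'I_n.+1 -> 'I_m.+1) :
  quasi_monotonic f ->
  exists! ab : seq nat * seq nat,
    [/\ multi_index m ab.1, multi_index n ab.2 & factors_as f ab.1 ab.2].
Proof.
move=> f_qm; exists (omitted f, zeros f); split.
  by split; [exact: multi_index_of.. | exact: factors_quasi_monotonic].
by case=> alpha beta [/= mi_a mi_b /(factors_as_unique _ _ _ _ _ mi_a mi_b)[-> ->]].
Qed.
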